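(* Let $\mathrm{SU}(2)$ act on $\mathbb{C}\mathrm{P}^1$ in the natural way, let $\omega_{\mathrm{FS}}$ be the Fubini-Study form on $\mathbb{C}\mathrm{P}^1$, and let $e_1,e_2,e_3$ be the basis $$e_1=\begin{pmatrix}0&1\\-1&0\end{pmatrix},\quad e_2=\begin{pmatrix}0&i\\ i&0\end{pmatrix},\quad e_3=\begin{pmatrix}i&0\\0&-i\end{pmatrix}$$ of $\mathfrak{su}(2)$. If a twist $t=\sum_{1\le i<j\le 3}\frac12\lambda_{ij}\,e_i\wedge e_j\in\Lambda^2\mathfrak{su}(2)$ with $\lambda_{ij}\in\mathbb{R}$ satisfies $\lambda_{12}^2+\lambda_{13}^2+\lambda_{23}^2<1$, then $\omega_{\mathrm{FS}}$ can be deformed by $t$; that is, $\pi_{\mathrm{FS}}^t:=\pi_{\mathrm{FS}}-t_{\mathbb{C}\mathrm{P}^1}$, where $\pi_{\mathrm{FS}}$ is the Poisson structure induced by $\omega_{\mathrm{FS}}$, is a nondegenerate Poisson structure on $\mathbb{C}\mathrm{P}^1$ and hence induces a symplectic structure $\omega_{\mathrm{FS}}^t$ on $\mathbb{C}\mathrm{P}^1$.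
   Context: The natural action of $g=(a_{ij})\in\mathrm{SU}(2)$ on $\mathbb{C}\mathrm{P}^1$ is $g\cdot[z_1:z_2]=[a_{11}z_1+a_{12}z_2:a_{21}z_1+a_{22}z_2]$. The Fubini-Study form is normalized as $\frac{i}{2}\partial\bar\partial\log(|w|^2+1)$ in the affine coordinate $w$ on each standard chart; on $U_1=\{z_1\neq0\}$ with $x_1=\mathrm{Re}\frac{z_2}{z_1}$, $y_1=\mathrm{Im}\frac{z_2}{z_1}$ it is $\omega_{\mathrm{FS}}=\dfrac{dx_1\wedge dy_1}{(x_1^2+y_1^2+1)^2}$. For a manifold $M$ with an action $\sigma$ of $G$ and $X\in\mathfrak{g}$, $X_{M,p}=\frac{d}{ds}\big|_{s=0}\sigma_{\exp sX}(p)$. Elements $t\in\Lambda^2\mathfrak{g}$ are called twists; $t_M$ denotes the fundamental $2$-vector field on $M$, determined linearly by $(X\wedge Y)_M=X_M\wedge Y_M$. For a $2$-vector field $\pi$, $\pi^\sharp:T^*M\to TM$ is defined by $\langle\pi^\sharp(\alpha),\beta\rangle=\pi(\alpha,\beta)$; $\pi$ is nondegenerate if $\pi^\sharp_p$ is an isomorphism for every $p$, and Poisson if $[\pi,\pi]=0$ (Schouten bracket). A symplectic form $\omega$ and a nondegenerate Poisson structure $\pi$ induce each other via $\pi^\sharp(\iota_v\omega)=v$ for all tangent vectors $v$. A symplectic form $\omega$ is said to be deformed by the twist $t$ if $\pi-t_M$ is a nondegenerate Poisson structure, the deformed symplectic structure being the one it induces. *)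

(* Defs.v *)
From HB Require Import structures.
From mathcomp Require Import all_boot all_order all_algebra.
From mathcomp Require Import spectral sesquilinear.
From mathcomp Require Import all_classical all_reals all_analysis.
From mathcomp Require Import complex ring lra.

Set Implicit Arguments.
Unset Strict Implicit.
Unset Printing Implicit Defensive.

Import Order.TTheory GRing.Theory Num.Theory.
Import numFieldNormedType.Exports.

Local Open Scope classical_set_scope.
Local Open Scope complex_scope.
Local Open Scope sesquilinear_scope.
Local Open Scope ring_scope.

Section Smooth.
Variables (R : realType) (n : nat).
Implicit Types (A : set 'rV[R]_n) (f g : 'rV[R]_n -> R).

Definition partial (a : 'I_n) f : 'rV[R]_n -> R := 'D_(delta_mx 0 a) f.

(* [A] is meant to be open. *)
Fixpoint Ck (k : nat) A f : Prop :=
  (forall x, A x -> {for x, continuous f}) /\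
  if k is k'.+1 then
    forall a : 'I_n, (forall x, A x -> derivable f x (delta_mx 0 a)) /\
                     Ck k' A (partial a f)
  else True.

Definition smooth_on A f : Prop := forall k, Ck k A f.

Lemma CkS k A f : Ck k.+1 A f -> Ck k A f.
Proof.
elim: k f => [|k IH] f [cf df]; first by [].
split=> // a; have [? ?] := df a; split=> //; exact: IH.
Qed.

Lemma Ck_continuous k A f x : Ck k A f -> A x -> {for x, continuous f}.
Proof. by case: k => [|k] [+ _]; apply. Qed.

Lemma Ck_ext k A f g : open A -> (forall x, A x -> f x = g x) ->
  Ck k A f -> Ck k A g.
Proof.
move=> oA; elim: k f g => [|k IH] f g fg [cf df];
  have nfg x : A x -> \near x, f x = g x
    by move=> Ax; apply: filterS (open_nbhs_nbhs (conj oA Ax)) => y /fg.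
all: have cg x : A x -> {for x, continuous g}
  by move=> Ax; rewrite /prop_for /continuous_at -(fg _ Ax);
     apply: cvg_trans (cf _ Ax);
     exact: (@near_eq_cvg _ _ (nbhs x) _ f g (nfg x Ax)).
  by [].
split=> // a; have [d1 d2] := df a; split.
  by move=> x Ax; apply: near_eq_derivable (d1 x Ax); exact: nfg.
by apply: IH d2 => x Ax; apply: near_eq_derive; exact: nfg.
Qed.

Lemma Ck_cst k A c : Ck k A (cst c).
Proof.
elim: k c => [|k IH] c; first by split=> // x _; exact: cst_continuous.
split=> [x _|a]; first exact: cst_continuous.
split=> [x _|]; first exact: derivable_cst.
suff -> : partial a (cst c) = cst 0 by [].
by apply/funext => x; rewrite /partial derive_cst.
Qed.

Lemma is_derive_coord (j : 'I_n) (x v : 'rV[R]_n) :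
  is_derive x v (fun y : 'rV[R]_n => y 0 j) (v 0 j).
Proof.
have dj := @differentiable_coord R 1 n x 0 j.
apply: DeriveDef; first exact: diff_derivable.
rewrite deriveE//.
have L : linear (fun y : 'rV[R]_n => y 0 j : R^o).
  by move=> c u w; rewrite !mxE.
pose lj : {linear 'rV[R]_n -> R^o} :=
  HB.pack (fun y : 'rV[R]_n => y 0 j : R^o) (GRing.isLinear.Build _ _ _ _ _ L).
have cj : continuous lj by exact: coord_continuous.
exact: (congr1 (fun h => h v) (@diff_lin R 'rV[R]_n R^o lj x cj)).
Qed.

Lemma Ck_coord k A (j : 'I_n) : Ck k A (fun y => y 0 j).
Proof.
case: k => [|k].
  by split=> // x _; exact: coord_continuous.
split=> [x _|a]; first exact: coord_continuous.
split=> [x _|].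
  exact: (@ex_derive _ _ _ _ _ _ _ (is_derive_coord j x (delta_mx 0 a))).
suff -> : partial a (fun y : 'rV[R]_n => y 0 j) =
    cst ((delta_mx 0 a : 'rV[R]_n) 0 j) by exact: Ck_cst.
apply/funext => x; rewrite /partial.
exact: (@derive_val _ _ _ _ _ _ _ (is_derive_coord j x (delta_mx 0 a))).
Qed.

Lemma CkD k A f g : open A -> Ck k A f -> Ck k A g -> Ck k A (f \+ g).
Proof.
move=> oA; elim: k f g => [|k IH] f g [cf df] [cg dg].
  by split=> // x Ax; apply: continuousD; [exact: cf|exact: cg].
split=> [x Ax|a]; first by apply: continuousD; [exact: cf|exact: cg].
have [df1 df2] := df a; have [dg1 dg2] := dg a; split=> [x Ax|].
  by apply: derivableD; [exact: df1|exact: dg1].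
apply: (@Ck_ext _ _ (partial a f \+ partial a g)) => //; last exact: IH.
by move=> x Ax; rewrite /partial /= (deriveD (df1 x Ax) (dg1 x Ax)).
Qed.

Lemma CkM k A f g : open A -> Ck k A f -> Ck k A g -> Ck k A (f \* g).
Proof.
move=> oA; elim: k f g => [|k IH] f g [cf df] [cg dg].
  by split=> // x Ax; apply: continuousM; [exact: cf|exact: cg].
split=> [x Ax|a]; first by apply: continuousM; [exact: cf|exact: cg].
have [df1 df2] := df a; have [dg1 dg2] := dg a; split=> [x Ax|].
  by apply: derivableM; [exact: df1|exact: dg1].
apply: (@Ck_ext _ _ ((f \* partial a g) \+ (g \* partial a f))) => //.
  by move=> x Ax; rewrite /partial /= (deriveM (df1 x Ax) (dg1 x Ax)).
by apply: CkD => //; apply: IH => //; apply: CkS; split.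
Qed.

Lemma CkV k A f : open A -> (forall x, A x -> f x != 0) -> Ck k A f ->
  Ck k A (fun x => (f x)^-1).
Proof.
move=> oA f0; elim: k => [|k IH] [cf df].
  by split=> // x Ax; apply: continuousV; [exact: f0|exact: cf].
split=> [x Ax|a]; first by apply: continuousV; [exact: f0|exact: cf].
have [df1 df2] := df a; split=> [x Ax|].
  by apply: derivableV; [exact: f0|exact: df1].
have Cf : Ck k A (fun x => (f x)^-1) by apply: IH; apply: CkS; split.
pose g x := (f x)^-1.
apply: (@Ck_ext _ _ (cst (-1) \* ((g \* g) \* partial a f))) => //.
  move=> x Ax; rewrite /partial (deriveV (f0 x Ax) (df1 x Ax))/=.
  by rewrite /GRing.scale/= -exprVn expr2 mulN1r mulNr.
by apply: CkM => //; [exact: Ck_cst|apply: CkM => //; exact: CkM].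
Qed.
End Smooth.

(* Smooth n-manifold without boundary given by a countable atlas; [chart i] and
   [param i] are only meaningful on [dom i] and on its image. [separated] is the
   Hausdorff property of the induced topology, second countability follows from
   countability of the atlas. *)
Record manifold (R : realType) (n : nat) := Manifold {
  mpoint :> Type;
  chart_index : countType;
  dom : chart_index -> set mpoint;
  chart : chart_index -> mpoint -> 'rV[R]_n;
  param : chart_index -> 'rV[R]_n -> mpoint;
  dom_cover : forall p, exists i, dom i p;
  chartK : forall i p, dom i p -> param i (chart i p) = p;
  overlap_open : forall i j, open (chart i @` (dom i `&` dom j));
  transition_smooth : forall i j a,
    smooth_on (chart i @` (dom i `&` dom j))
              (fun x => chart j (param i x) 0 a);
  separated : forall p q, p <> q ->
    exists i j (U V : set 'rV[R]_n),
      [/\ dom i p /\ dom j q, open U /\ U (chart i p), open V /\ V (chart j q) &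
          forall r, dom i r -> dom j r -> U (chart i r) -> ~ V (chart j r)] }.

Section Tensors.
Variables (R : realType) (n : nat) (M : manifold R n).

(* Fields of vectors and of 2-tensors are given by their components in every
   chart around every point (values outside the chart domains are irrelevant).
   Vectors and covectors are rows. *)
Definition vector_comps := chart_index M -> M -> 'rV[R]_n.
Definition tensor2_comps := chart_index M -> M -> 'M[R]_n.

(* A vector with row of components v in chart i has v *m transition_jac i j p in
   chart j. *)
Definition transition_jac (i j : chart_index M) (p : M) : 'M[R]_n :=
  'J (chart j \o param i) (chart i p).

Definition smooth_comp (i : chart_index M) (f : M -> R) : Prop :=
  smooth_on (chart i @` dom i) (f \o param i).

Definition chart_partial (i : chart_index M) (a : 'I_n) (f : M -> R) (p : M) : R :=
  partial a (f \o param i) (chart i p).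

Definition is_bivector (P : tensor2_comps) : Prop :=
  [/\ forall i p, dom i p -> (P i p)^T = - P i p,
      forall i j p, dom i p -> dom j p ->
        P j p = (transition_jac i j p)^T *m P i p *m transition_jac i j p &
      forall i a b, smooth_comp i (fun p => P i p a b)].

Definition is_two_form (w : tensor2_comps) : Prop :=
  [/\ forall i p, dom i p -> (w i p)^T = - w i p,
      forall i j p, dom i p -> dom j p ->
        w i p = transition_jac i j p *m w j p *m (transition_jac i j p)^T &
      forall i a b, smooth_comp i (fun p => w i p a b)].

(* <sharp P alpha, beta> = P(alpha, beta), and contract w v = w(v, .) *)
Definition sharp (P : 'M[R]_n) (alpha : 'rV[R]_n) : 'rV[R]_n := alpha *m P.
Definition contract (w : 'M[R]_n) (v : 'rV[R]_n) : 'rV[R]_n := v *m w.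

Definition nondegenerate_bivector (P : tensor2_comps) : Prop :=
  forall i p, dom i p -> bijective (sharp (P i p)).
Definition nondegenerate_form (w : tensor2_comps) : Prop :=
  forall i p, dom i p -> bijective (contract (w i p)).

(* Components of [P, Q], with the sign convention
   [X^Y, Z^W] = [X,Z]^Y^W - [X,W]^Y^Z - [Y,Z]^X^W + [Y,W]^X^Z *)
Definition schouten (P Q : tensor2_comps) i p (a b c : 'I_n) : R :=
  let S a b c := \sum_l (P i p c l * chart_partial i l (fun q => Q i q a b) p +
                         Q i p c l * chart_partial i l (fun q => P i q a b) p) in
  S a b c + S b c a + S c a b.

Definition ext_deriv (w : tensor2_comps) i p (a b c : 'I_n) : R :=
  chart_partial i a (fun q => w i q b c) p +
  chart_partial i b (fun q => w i q c a) p +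
  chart_partial i c (fun q => w i q a b) p.

Definition poisson_structure (P : tensor2_comps) : Prop :=
  is_bivector P /\ forall i p, dom i p -> forall a b c, schouten P P i p a b c = 0.

Definition symplectic_form (w : tensor2_comps) : Prop :=
  [/\ is_two_form w, nondegenerate_form w &
      forall i p, dom i p -> forall a b c, ext_deriv w i p a b c = 0].

Definition induces (w P : tensor2_comps) : Prop :=
  forall i p, dom i p -> forall v, sharp (P i p) (contract (w i p) v) = v.

Definition tensor2_sub (P Q : tensor2_comps) : tensor2_comps :=
  fun i p => P i p - Q i p.

Section Action.
(* [exp s X] stands for exp(sX). *)
Variables (G g : Type) (exp : R -> g -> G) (sigma : G -> M -> M).

(* Like a bivector on M, an element of the exterior square of g is an alternating
   bilinear form on the dual of g. Its values matter on linear functionals only: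
   [fundamental_bivector] evaluates it at X |-> alpha(X_M), which is linear. *)
Definition twist : Type := (g -> R) -> (g -> R) -> R.

Definition twist_wedge (X Y : g) : twist :=
  fun alpha beta => alpha X * beta Y - alpha Y * beta X.

Definition fundamental_field (X : g) : vector_comps :=
  fun i p => derive1 (fun s : R => chart i (sigma (exp s X) p)) 0.

Definition fundamental_bivector (t : twist) : tensor2_comps := fun i p =>
  \matrix_(a, b) t (fun X => fundamental_field X i p 0 a)
                   (fun X => fundamental_field X i p 0 b).

Lemma fundamental_bivector_wedge X Y i p :
  fundamental_bivector (twist_wedge X Y) i p =
  (fundamental_field X i p)^T *m fundamental_field Y i p -
  (fundamental_field Y i p)^T *m fundamental_field X i p.
Proof.
apply/matrixP => a b; rewrite /fundamental_bivector [LHS]mxE [RHS]mxE.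
rewrite [X in _ = _ + X]mxE.
by congr (_ - _); rewrite mxE big_ord1 mxE.
Qed.

Lemma fundamental_bivector_linear (c : R) (t u : twist) i p :
  fundamental_bivector (fun alpha beta => c * t alpha beta + u alpha beta) i p =
  c *: fundamental_bivector t i p + fundamental_bivector u i p.
Proof.
apply/matrixP => a b; rewrite /fundamental_bivector [LHS]mxE [RHS]mxE.
by congr (_ + _); rewrite !mxE.
Qed.
End Action.
End Tensors.

Section Exp.
Variables (R : realType) (k : nat).
Local Notation C := R[i].

Definition expmx_sum (A : 'M[C]_k.+1) (n : nat) : 'M[C]_k.+1 :=
  \sum_(j < n) (j`!%:R)^-1 *: A ^+ j.

(* Entrywise sum of the exponential series *)
Definition expmx (A : 'M[C]_k.+1) : 'M[C]_k.+1 :=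
  \matrix_(a, b)
    (limn (fun n => complex.Re (expmx_sum A n a b)) +i*
     limn (fun n => complex.Im (expmx_sum A n a b))).
End Exp.

Section SU2.
Variable R : realType.
Local Notation C := R[i].

Definition su2 : Type :=
  {X : 'M[C]_2 | (X ^t* == - X) && (\tr X == 0)}.
Definition SU2 : Type :=
  {g : 'M[C]_2 | (g \is unitarymx) && (\det g == 1)}.

Lemma ord2P (P : 'I_2 -> Prop) : P 0 -> P 1 -> forall i, P i.
Proof.
by move=> P0 P1 [[|[|//]] h]; [move: P0|move: P1]; congr P; apply/val_inj.
Qed.

Lemma mx2P (A B : 'M[C]_2) : A 0 0 = B 0 0 -> A 0 1 = B 0 1 ->
  A 1 0 = B 1 0 -> A 1 1 = B 1 1 -> A = B.
Proof. by move=> *; apply/matrixP; apply: ord2P; apply: ord2P. Qed.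

Lemma su2P (X : 'M[C]_2) : (X ^t* == - X) && (\tr X == 0) ->
  exists a b c : R, [/\ X 0 0 = 0 +i* a, X 0 1 = b +i* c,
     X 1 0 = (- b) +i* c & X 1 1 = 0 +i* (- a)].
Proof.
move=> /andP[/eqP/matrixP h /eqP]; rewrite /mxtrace big_ord_recl big_ord1.
have -> : lift ord0 ord0 = 1 :> 'I_2 by apply/val_inj.
have := h 0 0; have := h 0 1; have := h 1 1; rewrite !mxE.
case: (X 0 0) => a a'; case: (X 0 1) => b b'.
case: (X 1 0) => c c'; case: (X 1 1) => d d'.
move=> /eqP; rewrite eq_complex/= => /andP[/eqP h1 /eqP _].
move=> /eqP; rewrite eq_complex/= => /andP[/eqP h2 /eqP h3].
move=> /eqP; rewrite eq_complex/= => /andP[/eqP h4 /eqP _].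
move=> /eqP; rewrite eq_complex/= => /andP[/eqP h5 /eqP h6].
exists a', b, b'; split=> //; apply/eqP; rewrite eq_complex/=;
  apply/andP; split; apply/eqP; lra.
Qed.

Lemma det2 (A : 'M[C]_2) : \det A = A 0 0 * A 1 1 - A 0 1 * A 1 0.
Proof.
have l1 : lift ord0 ord0 = 1 :> 'I_2 by apply/val_inj.
rewrite (expand_det_row _ 0) !big_ord_recl big_ord0 addr0 /cofactor.
rewrite !det_mx11 !mxE /= expr0 expr1 mul1r mulN1r mulrN.
by rewrite !l1; congr (_ * A _ _ - _ * A _ _); apply/val_inj.
Qed.

Lemma su2_sqr (X : 'M[C]_2) : (X ^t* == - X) && (\tr X == 0) ->
  exists r : R, [/\ X *m X = ((- r ^+ 2)%:C)%:M, \det X = (r ^+ 2)%:C &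
                    r = 0 -> X = 0].
Proof.
move=> /su2P[a [b [c [h1 h2 h3 h4]]]].
pose N := a ^+ 2 + b ^+ 2 + c ^+ 2; exists (Num.sqrt N).
have N0 : 0 <= N by rewrite !addr_ge0// sqr_ge0.
rewrite sqr_sqrtr//; split.
- have l1 : lift ord0 ord0 = 1 :> 'I_2 by apply/val_inj.
  apply: mx2P; rewrite !mxE !big_ord_recl !big_ord0 ?l1 ?h1 ?h2 ?h3 ?h4;
  apply/eqP; rewrite eq_complex/=; apply/andP; split; apply/eqP; rewrite /N/=; ring.
- rewrite det2 h1 h2 h3 h4; apply/eqP; rewrite eq_complex/=.
  by apply/andP; split; apply/eqP; rewrite /N/=; ring.
- move=> /eqP; rewrite sqrtr_eq0 => N0'.
  have a0 : a = 0 by apply/eqP; rewrite -sqrf_eq0; apply/eqP;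
    have := sqr_ge0 a; have := sqr_ge0 b; have := sqr_ge0 c; rewrite /N in N0'; lra.
  have b0 : b = 0 by apply/eqP; rewrite -sqrf_eq0; apply/eqP;
    have := sqr_ge0 a; have := sqr_ge0 b; have := sqr_ge0 c; rewrite /N in N0'; lra.
  have c0 : c = 0 by apply/eqP; rewrite -sqrf_eq0; apply/eqP;
    have := sqr_ge0 a; have := sqr_ge0 b; have := sqr_ge0 c; rewrite /N in N0'; lra.
  by apply: mx2P; rewrite mxE ?h1 ?h2 ?h3 ?h4 ?a0 ?b0 ?c0 ?oppr0.
Qed.

Lemma expmx_su2 (X : 'M[C]_2) (r : R) : X *m X = ((- r ^+ 2)%:C)%:M ->
  (r = 0 -> X = 0) ->
  expmx X = ((cos r)%:C)%:M + (sin r / r)%:C *: X.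
Proof.
move=> XX r0X.
have Xeven n : X ^+ n.*2 = (((- r ^+ 2) ^+ n)%:C)%:M.
  elim: n => [|n IH]; first by rewrite !expr0.
  rewrite doubleS 2!(exprS X) IH mulrA -[X * X]/(X *m X) XX -mulmxE -scalar_mxM.
  by rewrite -rmorphM -exprS.
have sumE n : expmx_sum X n = ((series (cos_coeff r) n)%:C)%:M +
    (series (sin_coeff r) n / r)%:C *: X.
  rewrite /expmx_sum; elim: n => [|n IH].
    by rewrite big_ord0 /series/= !big_geq// mul0r scale0r addr0 raddf0.
  rewrite big_ord_recr/= {}IH /series/= !big_nat_recr//=.
  rewrite mulrDl !rmorphD/= scalerDl addrACA; congr (_ + _).
  have -> : (n`!%:R : C)^-1 = ((n`!%:R)^-1)%:C by rewrite fmorphV rmorph_nat.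
  have := odd_double_half n; case: (odd n) => /= nE.
    rewrite -nE/= /cos_coeff /sin_coeff /= odd_double/= !mul0r raddf0 add0r.
    rewrite exprS Xeven -[X * _]/(X *m _) mul_mx_scalar scalerA -rmorphM.
    have [r_0|r_neq0] := eqVneq r 0; first by rewrite r0X// !scaler0.
    congr (_%:C *: _); rewrite add0n doubleK add1n (exprS r n./2.*2) (exprNn (r ^+ 2)) -mul2n exprM.
    move: (_`!%:R^-1) ((-1) ^+ _) ((r ^+ 2) ^+ _) => u v w.
    by rewrite mul1r; field.
  rewrite -nE/= /cos_coeff /sin_coeff /= add0n odd_double/= !mul0r scale0r addr0.
  rewrite Xeven scale_scalar_mx -rmorphM; congr (_%:C)%:M.
  by rewrite doubleK (exprNn (r ^+ 2)) -mul2n exprM mul1r mulrC.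
have cvc := @is_cvg_series_cos_coeff R r; have cvs := @is_cvg_series_sin_coeff R r.
have lc : limn (series (cos_coeff r)) = cos r by rewrite unlock.
have ls : limn (series (sin_coeff r)) = sin r by rewrite unlock.
have key (u v : R) : limn (fun n => series (cos_coeff r) n * u +
    series (sin_coeff r) n / r * v) = cos r * u + sin r / r * v.
  apply/cvg_lim => //; apply: cvgD; apply: cvgMr_tmp.
    by rewrite -lc.
  by apply: cvgMr_tmp; rewrite -ls.
apply/matrixP => a b; rewrite !mxE.
have ReE n : complex.Re (expmx_sum X n a b) =
    series (cos_coeff r) n * (a == b)%:R +
    series (sin_coeff r) n / r * complex.Re (X a b).
  rewrite sumE !mxE; case: (X a b) => u v.
  by case: (a == b); rewrite ?mulr1n ?mulr0n/= ?mul0r ?subr0 ?mulr1 ?mulr0.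
have ImE n : complex.Im (expmx_sum X n a b) =
    series (cos_coeff r) n * 0 +
    series (sin_coeff r) n / r * complex.Im (X a b).
  rewrite sumE !mxE; case: (X a b) => u v.
  by case: (a == b); rewrite ?mulr1n ?mulr0n/= ?mul0r ?addr0 ?mulr0.
rewrite (funext ReE) (funext ImE) !key.
case: (X a b) => u v; case: (a == b);
  rewrite ?mulr1n ?mulr0n; apply/eqP; rewrite eq_complex/=;
  by rewrite ?mul0r ?subr0 ?addr0 ?mulr1 ?mulr0 ?eqxx.
Qed.

Lemma su2Z (s : R) (X : 'M[C]_2) : (X ^t* == - X) && (\tr X == 0) ->
  ((s%:C *: X) ^t* == - (s%:C *: X)) && (\tr (s%:C *: X) == 0).
Proof.
move=> /andP[/eqP hX /eqP tX]; rewrite mxtraceZ tX mulr0 eqxx andbT.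
apply/eqP; rewrite -scalerN -hX; apply/matrixP => a b; rewrite !mxE rmorphM/=.
by congr (_ * _); apply/eqP; rewrite eq_complex/= oppr0 !eqxx.
Qed.

Lemma expmx_SU2 (X : 'M[C]_2) : (X ^t* == - X) && (\tr X == 0) ->
  (expmx X \is unitarymx) && (\det (expmx X) == 1).
Proof.
move=> hX; have [r [XX dX r0]] := su2_sqr hX.
have tX : X 1 1 = - X 0 0.
  have [a [b [c [-> _ _ ->]]]] := su2P hX.
  by apply/eqP; rewrite eq_complex/= oppr0 !eqxx.
have [/eqP hX' _] := andP hX.
rewrite (expmx_su2 XX r0); set c := cos r; set t := sin r / r.
have ct : c ^+ 2 + t ^+ 2 * r ^+ 2 = 1.
  rewrite -(cos2Dsin2 r) /c /t; have [->|rn0] := eqVneq r 0.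
    by rewrite sin0 !mul0r !expr0n/= mul0r.
  by congr (_ + _); field.
apply/andP; split.
  apply/unitarymxP.
  have -> : (c%:C%:M + t%:C *: X) ^t* = c%:C%:M - t%:C *: X.
    rewrite -scalerN -hX'; apply/matrixP => a b; rewrite !mxE.
    rewrite rmorphD rmorphM/= eq_sym. congr (_ + _ * _).
      by case: (a == b); rewrite ?mulr1n ?mulr0n; apply/eqP; rewrite eq_complex/= ?oppr0 ?eqxx.
    by apply/eqP; rewrite eq_complex/= oppr0 !eqxx.
  rewrite mulmxBr !mulmxDl -scalar_mxM mul_scalar_mx mul_mx_scalar.
  rewrite -!scalemxAl -!scalemxAr XX !scale_scalar_mx.
  rewrite scalerA opprD addrA addrK -raddfB/=.
  congr (_%:M); rewrite -!rmorphM -rmorphB/= -[RHS](rmorph1 (real_complex R)).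
  by rewrite -ct; congr (_%:C); ring.
rewrite det2 !mxE tX/= mulr1n mulr0n !add0r.
have -> : 1 = c%:C ^+ 2 + t%:C ^+ 2 * \det X.
  by rewrite dX -!rmorphXn -rmorphM -rmorphD/= ct.
by rewrite det2 tX; apply/eqP; ring.
Qed.
End SU2.

Section CP1.
Variable R : realType.
Local Notation C := R[i].

(* The points are the lines of C^2; [line z] is the point [z_1 : z_2]. *)
Definition CP1 : Type := {U : {vspace 'cV[C]_2} | \dim U == 1%N}.

Fact dim_line (z : 'cV[C]_2) : z != 0 -> \dim <[z]>%VS == 1%N.
Proof. by move=> z0; rewrite dim_vline z0. Qed.

Definition line (z : 'cV[C]_2) (z0 : z != 0) : CP1 := exist _ <[z]>%VS (dim_line z0).

(* Some homogeneous coordinates of p *)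
Definition hcoord (p : CP1) : 'cV[C]_2 := vpick (val p).

Lemma hcoord_neq0 p : hcoord p != 0.
Proof.
rewrite /hcoord vpick0; apply/eqP => p0.
by have := valP p; rewrite p0 dimv0.
Qed.

Lemma CP1P p : val p = <[hcoord p]>%VS.
Proof.
apply/esym/eqP; rewrite eqEdim -memvE memv_pick/=.
by rewrite dim_vline hcoord_neq0 (eqP (valP p)).
Qed.

Lemma hcoord_line z (z0 : z != 0) : exists2 c : C, c != 0 & hcoord (line z0) = c *: z.
Proof.
have /vlineP[c cE] : hcoord (line z0) \in <[z]>%VS by exact: memv_pick.
exists c => //; apply: contra_neq (hcoord_neq0 (line z0)) => c0.
by rewrite cE c0 scale0r.
Qed.

Definition C_of_rV (x : 'rV[R]_2) : C := x 0 0 +i* x 0 1.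
Definition rV_of_C (w : C) : 'rV[R]_2 :=
  \row_a (if a == 0 then complex.Re w else complex.Im w).

Lemma C_of_rVK : cancel C_of_rV rV_of_C.
Proof. by move=> x; apply/rowP; apply: ord2P; rewrite mxE. Qed.

Definition CP1_dom (k : 'I_2) : set CP1 := [set p | hcoord p k 0 != 0].
(* Affine coordinates z_2 / z_1 on {z_1 != 0} and z_1 / z_2 on {z_2 != 0}; the
   indices of z are 0 and 1. *)
Definition CP1_chart (k : 'I_2) (p : CP1) : 'rV[R]_2 :=
  rV_of_C (hcoord p (rev_ord k) 0 / hcoord p k 0).

Definition affine (k : 'I_2) (w : C) : 'cV[C]_2 := \col_i (if i == k then 1 else w).

Fact affine_neq0 k w : affine k w != 0.
Proof.
apply/eqP => /matrixP/(_ k 0); rewrite !mxE eqxx => /eqP.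
by rewrite oner_eq0.
Qed.

Definition CP1_param (k : 'I_2) (x : 'rV[R]_2) : CP1 :=
  line (affine_neq0 k (C_of_rV x)).

Lemma line_eq z z' (z0 : z != 0) (z0' : z' != 0) (c : C) :
  z' = c *: z -> line z0' = line z0.
Proof.
move=> zE; apply/val_inj/eqP; rewrite /= eqEdim !dim_vline z0 z0' leqnn andbT.
by rewrite -memvE zE memvZ// memv_line.
Qed.

Lemma CP1_dom_line k z (z0 : z != 0) : CP1_dom k (line z0) <-> z k 0 != 0.
Proof.
rewrite /CP1_dom/=; have [c c0 ->] := hcoord_line z0.
by rewrite mxE mulf_eq0 (negPf c0).
Qed.

Lemma CP1_chart_line k z (z0 : z != 0) :
  CP1_chart k (line z0) = rV_of_C (z (rev_ord k) 0 / z k 0).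
Proof.
rewrite /CP1_chart; have [c c0 ->] := hcoord_line z0.
by rewrite !mxE invfM mulrACA divff// mul1r.
Qed.

Lemma rev2_neq (k : 'I_2) : rev_ord k != k.
Proof. by elim/ord2P: k. Qed.

Lemma rev2P (k i : 'I_2) : i = k \/ i = rev_ord k.
Proof.
have [->|ik] := eqVneq i k; [by left|right].
by apply/val_inj; move: i k ik => [[|[|//]] ?] [[|[|//]] ?].
Qed.

Lemma CP1_dom_param k x : CP1_dom k (CP1_param k x).
Proof. by apply/CP1_dom_line; rewrite mxE eqxx oner_neq0. Qed.

Lemma CP1_paramK k x : CP1_chart k (CP1_param k x) = x.
Proof.
rewrite CP1_chart_line !mxE eqxx (negPf (rev2_neq k)) divr1.
exact: C_of_rVK.
Qed.

Lemma CP1_chartK k p : CP1_dom k p -> CP1_param k (CP1_chart k p) = p.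
Proof.
rewrite /CP1_dom/= => pk; apply/val_inj => /=; rewrite [RHS]CP1P.
have E : affine k (C_of_rV (CP1_chart k p)) = (hcoord p k 0)^-1 *: hcoord p.
  apply/colP => i; have [->|->] := rev2P k i.
    by rewrite !mxE eqxx mulVf.
  rewrite !mxE (negPf (rev2_neq k)) mulrC /C_of_rV !mxE/=.
  by case: (_ * _).
exact: (congr1 val (line_eq (hcoord_neq0 p) (affine_neq0 _ _) E)).
Qed.

Lemma CP1_dom_rev k x : CP1_dom (rev_ord k) (CP1_param k x) <-> C_of_rV x != 0.
Proof. by rewrite CP1_dom_line mxE (negPf (rev2_neq k)). Qed.

Lemma CP1_transition k x :
  CP1_chart (rev_ord k) (CP1_param k x) = rV_of_C (C_of_rV x)^-1.
Proof.
by rewrite CP1_chart_line !mxE rev_ordK eqxx (negPf (rev2_neq k)) mul1r.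
Qed.

Definition normsq (x : 'rV[R]_2) : R := x 0 0 ^+ 2 + x 0 1 ^+ 2.

Lemma normsq_eq0 x : (normsq x == 0) = (C_of_rV x == 0).
Proof. by rewrite paddr_eq0 ?sqr_ge0// !sqrf_eq0 eq_complex. Qed.

Lemma normsq_Ck k A : open A -> Ck k A normsq.
Proof.
move=> oA; have -> : normsq = ((fun x => x 0 0) \* (fun x => x 0 0)) \+
    ((fun x => x 0 1) \* (fun x => x 0 1)).
  by apply/funext => x; rewrite /normsq !expr2.
by apply: CkD => //; apply: CkM => //; exact: Ck_coord.
Qed.

Lemma normsq_continuous : continuous normsq.
Proof. by move=> x; apply: (Ck_continuous (normsq_Ck 0 openT)). Qed.

Lemma CP1_image k : CP1_chart k @` CP1_dom k = setT.
Proof.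
apply/seteqP; split=> // x _; exists (CP1_param k x); last exact: CP1_paramK.
exact: CP1_dom_param.
Qed.

Lemma CP1_overlap k : CP1_chart k @` (CP1_dom k `&` CP1_dom (rev_ord k)) =
  [set x | normsq x != 0].
Proof.
apply/seteqP; split=> x /=.
  move=> [p [pk pk'] <-]; rewrite normsq_eq0; apply/(CP1_dom_rev k).
  by rewrite CP1_chartK.
rewrite normsq_eq0 => x0; exists (CP1_param k x); last exact: CP1_paramK.
by split; [exact: CP1_dom_param | apply/CP1_dom_rev].
Qed.

Lemma open_normsq_neq0 : open [set x | normsq x != 0].
Proof.
have -> : [set x | normsq x != 0] = normsq @^-1` (~` [set 0]).
  by apply/seteqP; split=> x /= /eqP.
apply: open_comp; last by apply: closed_openC; exact: closed_eq.
by move=> x _; exact: normsq_continuous.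
Qed.

Lemma CP1_overlap_open i j : open (CP1_chart i @` (CP1_dom i `&` CP1_dom j)).
Proof.
have [->|->] := rev2P i j; first by rewrite setIid CP1_image; exact: openT.
by rewrite CP1_overlap; exact: open_normsq_neq0.
Qed.

Lemma CP1_transition_smooth i j a :
  smooth_on (CP1_chart i @` (CP1_dom i `&` CP1_dom j))
            (fun x => CP1_chart j (CP1_param i x) 0 a).
Proof.
have [->|->] := rev2P i j => m.
  under eq_fun do rewrite CP1_paramK.
  exact: Ck_coord.
rewrite CP1_overlap; have oN := open_normsq_neq0.
have CV : Ck m [set x | normsq x != 0] (fun x => (normsq x)^-1).
  by apply: CkV => //; exact: normsq_Ck.
elim/ord2P: a.
  apply: (@Ck_ext _ _ _ _ ((fun x : 'rV[R]_2 => x 0 0) \* (fun x => (normsq x)^-1))) => //.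
    by move=> x _; rewrite CP1_transition mxE.
  by apply: CkM => //; exact: Ck_coord.
apply: (@Ck_ext _ _ _ _ (cst (-1) \* ((fun x : 'rV[R]_2 => x 0 1) \* (fun x => (normsq x)^-1)))) => //.
  by move=> x _; rewrite CP1_transition mxE/= mulN1r.
by apply: CkM => //; [exact: Ck_cst | apply: CkM => //; exact: Ck_coord].
Qed.

Lemma CP1_cover p : exists k, CP1_dom k p.
Proof.
apply/not_existsP => h; have /eqP := hcoord_neq0 p; apply.
apply/colP => k; rewrite mxE; apply/eqP/negPn/negP => hk.
exact: (h k hk).
Qed.

Lemma CP1_separated (p q : CP1) : p <> q ->
  exists i j (U V : set 'rV[R]_2),
    [/\ CP1_dom i p /\ CP1_dom j q, open U /\ U (CP1_chart i p),
        open V /\ V (CP1_chart j q) &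
        forall r, CP1_dom i r -> CP1_dom j r ->
          U (CP1_chart i r) -> ~ V (CP1_chart j r)].
Proof.
move=> pq; have [i ip] := CP1_cover p; have [j jq] := CP1_cover q.
have sep k : CP1_dom k p -> CP1_dom k q -> exists i j (U V : set 'rV[R]_2),
    [/\ CP1_dom i p /\ CP1_dom j q, open U /\ U (CP1_chart i p),
        open V /\ V (CP1_chart j q) &
        forall r, CP1_dom i r -> CP1_dom j r ->
          U (CP1_chart i r) -> ~ V (CP1_chart j r)].
  move=> kp kq; have pq' : CP1_chart k p != CP1_chart k q.
    by apply: contra_notN pq => /eqP E; rewrite -(CP1_chartK kp) E CP1_chartK.
  have H : hausdorff_space 'rV[R]_2 by exact: norm_hausdorff.
  move: H; rewrite open_hausdorff => /(_ _ _ pq')[[U V] /= [Up Vq] [oU oV /eqP UV]].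
  exists k, k, U, V; split=> //; [split=> //; exact: set_mem..|].
  move=> r _ _ Ur Vr; suff : (U `&` V) (CP1_chart k r) by rewrite UV.
  by split.
have [jp|jp] := pselect (CP1_dom j p); first exact: (sep j).
have [iq|iq] := pselect (CP1_dom i q); first exact: (sep i).
have ji : j = rev_ord i by have [ji|//] := rev2P i j; rewrite ji in jp.
subst j; pose B := [set x | normsq x < 1].
have oB : open B.
  have -> : B = normsq @^-1` [set y | y < 1] by [].
  apply: open_comp; last exact: open_lt.
  by move=> x _; exact: normsq_continuous.
have B0 : B 0 by rewrite /B /normsq/= !mxE expr0n/= addr0.
have z0 k r : ~ CP1_dom (rev_ord k) r -> CP1_chart k r = 0.
  move=> /negP; rewrite negbK => /eqP r0; rewrite /CP1_chart r0 mul0r.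
  by apply/rowP; apply: ord2P; rewrite !mxE.
exists i, (rev_ord i), B, B; split=> //.
- by rewrite z0.
- by rewrite z0// rev_ordK.
move=> r ir; rewrite -(CP1_chartK ir) CP1_transition CP1_paramK.
move: (CP1_chart i r) => x; rewrite CP1_dom_rev -normsq_eq0 /B/= => x0.
have -> : normsq (rV_of_C (C_of_rV x)^-1) = (normsq x)^-1.
  by rewrite /normsq !mxE/= -/(normsq x); rewrite /normsq in x0 *; field.
move=> x1; have xp : 0 < normsq x by rewrite lt_neqAle eq_sym x0 addr_ge0 ?sqr_ge0.
by apply/negP; rewrite -leNgt invf_ge1// ltW.
Qed.

Definition CP1_manifold : manifold R 2 := {|
  dom := CP1_dom; dom_cover := CP1_cover; chartK := CP1_chartK;
  overlap_open := CP1_overlap_open;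
  transition_smooth := CP1_transition_smooth;
  separated := CP1_separated |}.
End CP1.

Section CP1_action.
Variable R : realType.
Local Notation C := R[i].

Lemma act_line (g : 'M[C]_2) (z : 'cV[C]_2) :
  (linfun (mulmx g) @: <[z]>)%VS = <[g *m z]>%VS.
Proof. by rewrite limg_line lfunE. Qed.

Fact act_dim (g : SU2 R) (p : CP1 R) :
  \dim (linfun (mulmx (val g)) @: val p)%VS == 1%N.
Proof.
rewrite CP1P act_line dim_vline; have := hcoord_neq0 p.
suff -> : (val g *m hcoord p == 0) = (hcoord p == 0) by case: eqP.
have /andP[/unitarymx_unit gU _] := valP g.
by rewrite -{1}(mulmx0 _ (val g)) (inj_eq (can_inj (mulKmx gU))).
Qed.

Definition SU2_act (g : SU2 R) (p : CP1 R) : CP1 R :=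
  exist _ (linfun (mulmx (val g)) @: val p)%VS (act_dim g p).

Definition exp_su2 (s : R) (X : su2 R) : SU2 R :=
  exist _ (expmx (s%:C *: val X)) (expmx_SU2 (su2Z s (valP X))).

Definition mx2 (a b c d : C) : 'M[C]_2 :=
  \matrix_(i, j) (if i == 0 then (if j == 0 then a else b)
                  else (if j == 0 then c else d)).

Fact su2_mx2 (a b c d : C) : a^*%C = - a -> c = - b^*%C -> d = - a ->
  ((mx2 a b c d) ^t* == - mx2 a b c d) && (\tr (mx2 a b c d) == 0).
Proof.
move=> aa -> ->; apply/andP; split.
  case: a aa => a1 a2 /eqP; rewrite eq_complex/= => /andP[/eqP a1N _].
  case: b => b1 b2; apply/eqP/mx2P; rewrite !mxE/=;
  by apply/eqP; rewrite eq_complex/= ?opprK -?a1N ?eqxx.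
rewrite /mxtrace big_ord_recl big_ord1 !mxE/=.
by rewrite subrr.
Qed.

Fact e1_proof :
  ((mx2 0 1 (-1) 0) ^t* == - mx2 0 1 (-1) 0) && (\tr (mx2 0 1 (-1) 0) == 0).
Proof. by apply: su2_mx2; rewrite ?oppr0 ?conjc0 ?conjc1. Qed.

Fact e2_proof : ((mx2 0 'i%C 'i%C 0) ^t* == - mx2 0 'i%C 'i%C 0) &&
  (\tr (mx2 0 'i%C 'i%C 0) == 0).
Proof.
apply: su2_mx2; rewrite ?oppr0 ?conjc0//.
by apply/eqP; rewrite eq_complex/= oppr0 opprK !eqxx.
Qed.

Fact e3_proof : ((mx2 'i%C 0 0 (- 'i%C)) ^t* == - mx2 'i%C 0 0 (- 'i%C)) &&
  (\tr (mx2 'i%C 0 0 (- 'i%C)) == 0).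
Proof.
apply: su2_mx2; rewrite ?oppr0 ?conjc0 ?oppr0//.
by apply/eqP; rewrite eq_complex/= oppr0 !eqxx.
Qed.

Definition e1 : su2 R := exist _ (mx2 0 1 (-1) 0) e1_proof.
Definition e2 : su2 R := exist _ (mx2 0 'i%C 'i%C 0) e2_proof.
Definition e3 : su2 R := exist _ (mx2 'i%C 0 0 (- 'i%C)) e3_proof.

(* (i/2) ddbar log(|w|^2 + 1) = dx /\ dy / (x^2 + y^2 + 1)^2 for the affine
   coordinate w = x + iy of either chart *)
Definition omegaFS : tensor2_comps (CP1_manifold R) := fun k p =>
  (normsq (CP1_chart k p) + 1) ^- 2 *: (delta_mx 0 1 - delta_mx 1 0).

Definition su2_twist (l12 l13 l23 : R) : twist R (su2 R) := fun alpha beta =>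
  1 / 2 * l12 * twist_wedge e1 e2 alpha beta +
  1 / 2 * l13 * twist_wedge e1 e3 alpha beta +
  1 / 2 * l23 * twist_wedge e2 e3 alpha beta.

Definition CP1_fundamental (t : twist R (su2 R)) :
    tensor2_comps (CP1_manifold R) :=
  fundamental_bivector (M := CP1_manifold R) exp_su2 SU2_act t.
End CP1_action.

(* Main.v *)
(* Each chart of CP^1 carries a global coordinate w = x + iy, in which a bivector
   is a function h times d/dx /\ d/dy. In dimension two every bivector is Poisson
   and every 2-form is closed, so only gluing and nondegeneracy matter. The
   transition w |-> 1/w has Jacobian determinant |w|^-4, and for the
   Fubini-Study structure h = -(|w|^2 + 1)^2. Differentiating the Moebius action
   at the identity gives h = (|w|^2 + 1) <lambda, V> / 2 for the twist, where
   V = (+-(|w|^2 - 1), 2x, -+2y). Stereographic projection shows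
   |V| = |w|^2 + 1, hence |lambda| < 1 keeps the difference negative by
   Cauchy-Schwarz. *)

Require Import Defs.
From mathcomp Require Import all_boot all_order all_algebra.
From mathcomp Require Import all_classical all_reals all_analysis.
From mathcomp Require Import complex ring lra.

Set Implicit Arguments.
Unset Strict Implicit.
Unset Printing Implicit Defensive.

Import Order.TTheory GRing.Theory Num.Theory.
Import numFieldNormedType.Exports.
Local Open Scope classical_set_scope.
Local Open Scope complex_scope.
Local Open Scope ring_scope.

(** * Derivatives of real-valued and row-valued maps *)

Lemma is_derive_row (R : realType) (V : normedModType R) (n : nat)
    (f : V -> 'rV[R]_n) (d : 'rV[R]_n) (x v : V) :
  (forall j, is_derive x v (fun y => f y 0 j) (d 0 j)) -> is_derive x v f d.
Proof.
move=> H; have df : derivable f x v.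
  by apply/derivable_mxP => i j; rewrite ord1; exact: ex_derive.
apply: DeriveDef => //; rewrite derive_mx//; apply/rowP => j; rewrite mxE.
exact: derive_val.
Qed.

(** Like the three lemmas that follow, it is phrased on explicit functions with ring operations
    instead of scalings, so that derivatives of rational expressions can be assembled as proof
    terms. *)
Lemma is_derive_add (R : realType) (V : normedModType R) (f g : V -> R)
    (x v : V) (a b : R) : is_derive x v f a -> is_derive x v g b ->
  is_derive x v (fun y => f y + g y) (a + b).
Proof. exact: is_deriveD. Qed.

Lemma is_derive_mul (R : realType) (V : normedModType R) (f g : V -> R)
    (x v : V) (a b : R) : is_derive x v f a -> is_derive x v g b ->
  is_derive x v (fun y => f y * g y) (a * g x + f x * b).
Proof.
move=> Hf Hg; have Hfg : is_derive x v (fun y => f y * g y) (f x *: b + g x *: a).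
  exact: is_deriveM.
by apply: is_derive_eq Hfg _; rewrite /GRing.scale/= addrC (mulrC (g x)).
Qed.

Lemma is_derive_inv (R : realType) (V : normedModType R) (f : V -> R)
    (x v : V) (a : R) : f x != 0 -> is_derive x v f a ->
  is_derive x v (fun y => (f y)^-1) (- a / f x ^+ 2).
Proof.
move=> f0 Hf; have df := @ex_derive _ _ _ _ _ _ _ Hf; apply: DeriveDef.
  exact: derivableV.
by rewrite deriveV// derive_val /GRing.scale/= mulNr mulrC mulNr.
Qed.

Lemma is_derive_mulr (R : realType) (V : normedModType R) (f : V -> R) (c : R)
    (x v : V) (a : R) : is_derive x v f a -> is_derive x v (fun y => f y * c) (a * c).
Proof.
move=> Hf; have := is_derive_mul Hf (is_derive_cst c x v).
by rewrite mulr0 addr0.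
Qed.

(** * Fundamental vector fields on $\mathbb{C}P^1$ *)

Lemma derive1_fraction (R : realType) (w u v : R[i]) :
  derive1 (fun s => rV_of_C (((cos s)%:C * w + (sin s)%:C * u) /
                             ((cos s)%:C + (sin s)%:C * v))) 0 =
  rV_of_C (u - w * v).
Proof.
case: w u v => [w1 w2] [u1 u2] [v1 v2]; rewrite derive1E; apply: derive_val.
have lin a b : is_derive (0 : R) 1 (fun s => cos s * a + sin s * b) b.
  have H := is_derive_add (is_derive_mulr a (is_derive_cos 0))
    (is_derive_mulr b (is_derive_sin 0)).
  apply: is_derive_eq H _.
  by rewrite sin0 cos0 /cst/=; ring.
(* The numerator is $A+iB$ and the denominator $P+iQ$. The factors [1] and [0] keep all four
   functions in the shape covered by [lin]. *)
pose A s := cos s * w1 + sin s * u1; pose B s := cos s * w2 + sin s * u2.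
pose P s := cos s * 1 + sin s * v1; pose Q s := cos s * 0 + sin s * v2.
have N0 : P 0 * P 0 + Q 0 * Q 0 != 0.
  by rewrite /P /Q cos0 sin0 !(mul0r, mulr0, addr0, mulr1) oner_neq0.
have DV : is_derive (0 : R) 1 (fun s => (P s * P s + Q s * Q s)^-1) (- 2 * v1).
  have DN := is_derive_add (is_derive_mul (lin 1 v1) (lin 1 v1))
    (is_derive_mul (lin 0 v2) (lin 0 v2)).
  apply: is_derive_eq (is_derive_inv (f := fun s => P s * P s + Q s * Q s) N0 DN) _.
  by rewrite cos0 sin0 /P /Q cos0 sin0; field.
(* Multiplication by $(P-iQ)/(P^2+Q^2)$ separates real and imaginary parts; $-Q$ is spelled out so
   that [lin 0 (- v2)] applies. Where the denominator vanishes, both sides are 0 because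
   $0^{-1}=0$. *)
have fracE s : ((cos s)%:C * (w1 +i* w2) + (sin s)%:C * (u1 +i* u2)) /
      ((cos s)%:C + (sin s)%:C * (v1 +i* v2)) =
    (A s * P s + B s * Q s) * (P s * P s + Q s * Q s)^-1 +i*
    ((B s * P s + A s * (cos s * 0 + sin s * - v2)) * (P s * P s + Q s * Q s)^-1).
  rewrite /A /B /P /Q; apply/eqP; rewrite eq_complex/=; apply/andP; split; apply/eqP;
    rewrite !(mul0r, mulr0, mulr1, add0r, addr0, subr0, sub0r, oppr0) -!expr2; ring.
rewrite (funext (fun s => congr1 (@rV_of_C R) (fracE s))).
have E0 : [/\ A 0 = w1, B 0 = w2, P 0 = 1 & Q 0 = 0].
  by rewrite /A /B /P /Q cos0 sin0 !(mul0r, mulr0, addr0, mul1r).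
case: E0 => A0 B0 P0 Q0.
apply: is_derive_row; apply: ord2P; rewrite !mxE /=.
  under eq_fun do rewrite mxE /=.
  have DN := is_derive_add (is_derive_mul (lin w1 u1) (lin 1 v1))
    (is_derive_mul (lin w2 u2) (lin 0 v2)).
  apply: is_derive_eq (is_derive_mul DN DV) _.
  by rewrite -/(A 0) -/(B 0) -/(P 0) -/(Q 0) A0 B0 P0 Q0; field.
under eq_fun do rewrite mxE /=.
have DN := is_derive_add (is_derive_mul (lin w2 u2) (lin 1 v1))
  (is_derive_mul (lin w1 u1) (lin 0 (- v2))).
apply: is_derive_eq (is_derive_mul DN DV) _.
rewrite -/(A 0) -/(B 0) -/(P 0) -/(Q 0) A0 B0 P0 Q0.
by rewrite sin0 cos0; field.
Qed.

(** Splitting off an arbitrary index [k] lets one matrix computation serve both charts. *)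
Lemma big_rev2 (V : nmodType) (k : 'I_2) (F : 'I_2 -> V) :
  \sum_i F i = F k + F (rev_ord k).
Proof.
rewrite (bigD1 k)//=; congr (_ + _); apply: big_pred1 => i /=.
by have [->|->] := rev2P k i; rewrite ?eqxx ?rev2_neq // eq_sym (negPf (rev2_neq k)).
Qed.

(** Since $X^2=-1$, $\exp(sX)=\cos s+\sin s\,X$. If $v$ and $u$ are the entries [k] and [rev_ord k]
    of $X$ applied to [affine k w], the orbit in chart [k] is $(\cos s\,w+\sin s\,u)/(\cos s+\sin
    s\,v)$, with velocity $u-wv$ at $0$. *)
Lemma fundamental_field_CP1 (R : realType) (X : su2 R) (k : 'I_2) (x : 'rV[R]_2) :
  val X *m val X = (-1)%:M ->
  fundamental_field (M := CP1_manifold R) (@exp_su2 R) (@SU2_act R)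
    X k (CP1_param k x) =
  let w := C_of_rV x in
  rV_of_C (val X (rev_ord k) k + val X (rev_ord k) (rev_ord k) * w -
           w * (val X k k + val X k (rev_ord k) * w)).
Proof.
move=> XX; rewrite /fundamental_field/=; set w := C_of_rV x.
rewrite -derive1_fraction; congr (derive1 _ 0); apply/funext => s.
have sX : (s%:C *: val X) *m (s%:C *: val X) = ((- s ^+ 2)%:C)%:M.
  rewrite -scalemxAl -scalemxAr scalerA XX scale_scalar_mx -rmorphM.
  by rewrite rmorphN/= expr2 mulrN1.
have s0X : s = 0 -> s%:C *: val X = 0 by move=> ->; rewrite scale0r.
have expE : val (exp_su2 s X) = (cos s)%:C%:M + (sin s)%:C *: val X.
  rewrite /= (expmx_su2 sX s0X) scalerA -rmorphM/=; congr (_ + _%:C *: _).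
  (* At [s = 0] the quotient [sin s / s] is 0 by convention, yet its product with [s] is still
     [sin s]. *)
  by have [->|s0] := eqVneq s 0; [rewrite sin0 !mul0r|rewrite divfK].
set g := exp_su2 s X.
have gw : val g *m affine k w != 0.
  apply/negP => /eqP gw; have /andP[/unitarymx_unit gU _] := valP g.
  by have := affine_neq0 k w; rewrite -[affine k w](mulKmx gU) gw mulmx0 eqxx.
have -> : SU2_act g (CP1_param k x) = line gw.
  by apply/val_inj; rewrite /= act_line.
rewrite CP1_chart_line; congr (rV_of_C (_ / _));
  rewrite expE mulmxDl mul_scalar_mx -scalemxAl !mxE !(big_rev2 k) !mxE;
  by rewrite eqxx (negPf (rev2_neq k)) !mulr1.
Qed.

(** * Jacobians of the coordinate changes *)

Lemma differentiable_row (R : realType) (V : normedModType R) (n : nat)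
    (f : V -> 'rV[R]_n) (x : V) :
  (forall j, differentiable (fun y => f y 0 j) x) -> differentiable f x.
Proof.
move=> df; have -> : f = \sum_j (fun y => f y 0 j *: (delta_mx 0 j : 'rV[R]_n)).
  by apply/funext => y; rewrite fct_sumE; exact: row_sum_delta.
by apply: differentiable_sum => j; exact: differentiableZl.
Qed.

Lemma jacobian_entry (R : realType) (m n : nat) (f : 'rV[R]_m -> 'rV[R]_n)
    (x : 'rV[R]_m) (i : 'I_m) (j : 'I_n) (a : R) : differentiable f x ->
  is_derive x (delta_mx 0 i) (fun y => f y 0 j) a -> jacobian f x i j = a.
Proof.
move=> df fa; have := deriveEjacobian (delta_mx 0 i) df.
rewrite derive_mx; last exact: diff_derivable.
rewrite -rowE => /rowP/(_ j); rewrite !mxE => <-; exact: derive_val.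
Qed.

Lemma is_derive_normsq (R : realType) (x v : 'rV[R]_2) :
  is_derive x v (@normsq R) (2 * (x 0 0 * v 0 0 + x 0 1 * v 0 1)).
Proof.
have d i := is_derive_mul (is_derive_coord i x v) (is_derive_coord i x v).
by apply: is_derive_eq (is_derive_add (d 0) (d 1)) _; ring.
Qed.

Lemma differentiable_normsq (R : realType) (x : 'rV[R]_2) :
  differentiable (@normsq R) x.
Proof.
have d i := @differentiable_coord R 1 2 x 0 i.
exact: differentiableD (differentiableM (d 0) (d 0)) (differentiableM (d 1) (d 1)).
Qed.

Lemma matrix2P (T : Type) (A B : 'M[T]_2) : A 0 0 = B 0 0 -> A 0 1 = B 0 1 ->
  A 1 0 = B 1 0 -> A 1 1 = B 1 1 -> A = B.
Proof. by move=> *; apply/matrixP; apply: ord2P; apply: ord2P. Qed.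

Lemma det_mx2 (R : comPzRingType) (A : 'M[R]_2) :
  \det A = A 0 0 * A 1 1 - A 0 1 * A 1 0.
Proof.
have l0 : lift (0 : 'I_2) 0 = 1 by apply/val_inj.
have l1 : lift (1 : 'I_2) 0 = 0 by apply/val_inj.
have r0 : rev_ord 0 = 1 :> 'I_2 by apply/val_inj.
rewrite (expand_det_row _ 0) (big_rev2 0) r0 /cofactor !det_mx11 !mxE l0 l1.
by rewrite /= expr0 expr1 mul1r mulN1r mulrN.
Qed.

(** The map $w\mapsto 1/w$ is holomorphic with derivative $-w^{-2}$, so its real Jacobian
    determinant is $|w^{-2}|^2$. The proof computes the four partial derivatives of $x/|w|^2$ and
    $-y/|w|^2$. *)
Lemma det_jacobian_inv (R : realType) (x : 'rV[R]_2) : normsq x != 0 ->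
  \det (jacobian (fun y : 'rV[R]_2 => rV_of_C (C_of_rV y)^-1) x) =
  (normsq x ^+ 2)^-1.
Proof.
move=> x0; set f := fun y => _.
have f0E : (fun y => f y 0 0) = (fun y => y 0 0 * (normsq y)^-1).
  by apply/funext => y; rewrite mxE.
have f1E : (fun y => f y 0 1) = (fun y => y 0 1 * - 1 * (normsq y)^-1).
  by apply/funext => y; rewrite mxE/= mulrN1 mulNr.
have dV := differentiableV (differentiable_normsq x) x0.
have df : differentiable f x.
  apply: differentiable_row; apply: ord2P; rewrite ?f0E ?f1E.
    by apply: differentiableM => //; exact: differentiable_coord.
  apply: differentiableM => //; apply: differentiableM => //.
  exact: differentiable_coord.
have D i := is_derive_inv x0 (is_derive_normsq x (delta_mx 0 i)).
have H0 i := is_derive_mul (is_derive_coord 0 x _) (D i).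
have H1 i := is_derive_mul (is_derive_mulr (- 1) (is_derive_coord 1 x _)) (D i).
rewrite -f0E in H0; rewrite -f1E in H1.
have J0 i := jacobian_entry df (H0 i); have J1 i := jacobian_entry df (H1 i).
rewrite det_mx2 !J0 !J1 !mxE/= /normsq; rewrite /normsq in x0.
by field.
Qed.

Lemma det_transition_jac (R : realType) (k : 'I_2) (x : 'rV[R]_2) : normsq x != 0 ->
  \det (transition_jac (M := CP1_manifold R) k (rev_ord k) (CP1_param k x)) =
  (normsq x ^+ 2)^-1.
Proof.
move=> x0; rewrite /transition_jac/= CP1_paramK.
have -> : CP1_chart (rev_ord k) \o CP1_param k =
    (fun y : 'rV[R]_2 => rV_of_C (C_of_rV y)^-1).
  by apply/funext => y; exact: CP1_transition.
exact: det_jacobian_inv.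
Qed.

Lemma transition_jac_id (R : realType) (k : 'I_2) (p : CP1 R) :
  transition_jac (M := CP1_manifold R) k k p = 1%:M.
Proof.
rewrite /transition_jac/=.
have -> : CP1_chart k \o CP1_param k = @idfun 'rV[R]_2.
  by apply/funext => y; exact: CP1_paramK.
apply/matrixP => i j; rewrite [RHS]mxE; apply: jacobian_entry.
  by apply: differentiable_row => l; exact: differentiable_coord.
by apply: is_derive_eq (is_derive_coord _ _ _) _; rewrite mxE eqxx eq_sym.
Qed.

Lemma CP1_overlapE (R : realType) (k : 'I_2) (p : CP1 R) :
  CP1_dom k p -> CP1_dom (rev_ord k) p ->
  let x := CP1_chart k p in
  [/\ normsq x != 0, CP1_chart (rev_ord k) p = rV_of_C (C_of_rV x)^-1 &
      \det (transition_jac (M := CP1_manifold R) k (rev_ord k) p) = (normsq x ^+ 2)^-1].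
Proof.
move=> kp kp' x; have x0 : normsq x != 0.
  by rewrite normsq_eq0; apply/(CP1_dom_rev k); rewrite CP1_chartK.
split=> //; first by rewrite -(CP1_transition k) CP1_chartK.
by have := det_transition_jac k x0; rewrite CP1_chartK.
Qed.

(** * Bivectors and 2-forms on $\mathbb{C}P^1$ given by a density in each chart *)

Section AreaTensors.
Variables (R : realType).

(* d/dx /\ d/dy in the affine coordinate of either chart, and also dx /\ dy. *)
Definition area_mx : 'M[R]_2 := delta_mx 0 1 - delta_mx 1 0.
Local Notation J := area_mx.

Lemma area_mxE i j : J i j = if i == j then 0 else if i == 0 then 1 else -1.
Proof.
by move: i j; apply: ord2P; apply: ord2P; rewrite !mxE/= ?subr0 ?sub0r.
Qed.

Lemma area_mx_tr : J^T = - J.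
Proof. by apply: matrix2P; rewrite !mxE/=; ring. Qed.

(** As $J^2=-1$, the inverse of $cJ$ is $-c^{-1}J$; this is the sign that separates the density of a
    form from the reciprocal density of its bivector. *)
Lemma area_mx_mul (a b : R) : (a *: J) *m (b *: J) = (- (a * b))%:M.
Proof. by apply: matrix2P; rewrite !mxE !(big_rev2 0) !mxE/=; ring. Qed.

(** Multiples of $J$ form a line on which congruence acts by the determinant, so gluing involves
    only Jacobian determinants. *)
Lemma area_mx_congr (A : 'M[R]_2) : A *m J *m A^T = \det A *: J.
Proof.
have r0 : rev_ord 0 = 1 :> 'I_2 by apply/val_inj.
by rewrite det_mx2; apply: matrix2P; rewrite !(mxE, big_rev2 0, r0)/=; ring.
Qed.

Lemma mul_area_mx_bij (c : R) :
  c != 0 -> bijective (fun v : 'rV[R]_2 => v *m (c *: J)).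
Proof.
move=> c0; exists (fun v : 'rV[R]_2 => v *m (- c^-1 *: J)) => v /=;
  rewrite -mulmxA area_mx_mul ?mulrN ?mulNr opprK.
- by rewrite divff// mulmx1.
- by rewrite mulVf// mulmx1.
Qed.

(** Each chart is onto the plane, hence smoothness on [setT]; [PE] goes through [CP1_param] and so
    prescribes [P] exactly on the chart domains. *)
Variables (h : 'I_2 -> 'rV[R]_2 -> R) (P : tensor2_comps (CP1_manifold R)).
Hypothesis smooth_h : forall k, smooth_on setT (h k).
Hypothesis PE : forall k x, P k (CP1_param k x) = h k x *: J.

Lemma area_tensorE k p : CP1_dom k p -> P k p = h k (CP1_chart k p) *: J.
Proof. by move=> kp; rewrite -{1}(CP1_chartK kp) PE. Qed.

Lemma area_tr k p : CP1_dom k p -> (P k p)^T = - P k p.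
Proof. by move=> kp; rewrite area_tensorE// linearZ/= area_mx_tr scalerN. Qed.

Lemma area_comp k a b :
  (fun p => P k p a b) \o @CP1_param R k = (fun x => h k x * J a b).
Proof. by apply/funext => x /=; rewrite PE mxE. Qed.

Lemma area_smooth k a b : smooth_comp (M := CP1_manifold R) k (fun p => P k p a b).
Proof.
rewrite /smooth_comp/= CP1_image area_comp => m.
apply: (@CkM _ _ _ _ (h k) (cst (J a b))); first exact: openT.
  exact: smooth_h.
exact: Ck_cst.
Qed.

Lemma area_partial k l a b p :
  chart_partial (M := CP1_manifold R) k l (fun q => P k q a b) p =
  partial l (h k) (CP1_chart k p) * J a b.
Proof.
rewrite /chart_partial/= area_comp; set x := CP1_chart k p.
have dh : derivable (h k) x (delta_mx 0 l).
  by have [_ /(_ l)[+ _]] := smooth_h k 1; apply.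
exact: (@derive_val _ _ _ _ _ _ _ (is_derive_mulr _ (derivableP dh))).
Qed.

(** The components alternate in [a], [b], [c], and three indices with two possible values must
    repeat. The cyclic sum in [area_ext_deriv] vanishes for the same reason. *)
Lemma area_schouten k p a b c : CP1_dom k p -> schouten P P k p a b c = 0.
Proof.
move=> kp; rewrite /schouten !(big_rev2 0) !area_partial area_tensorE//.
set x := CP1_chart k p; move: (partial _ _ _) (partial _ _ _) => u v.
rewrite !mxE; move: a b c.
do 3!apply: ord2P; rewrite /=; ring.
Qed.

Lemma area_ext_deriv k p a b c : ext_deriv P k p a b c = 0.
Proof.
rewrite /ext_deriv !area_partial !area_mxE.
by move: a b c; do 3!apply: ord2P; rewrite /=; ring.
Qed.

Lemma area_bivector :
  (forall k x, normsq x != 0 ->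
    h (rev_ord k) (rV_of_C (C_of_rV x)^-1) = h k x / normsq x ^+ 2) ->
  is_bivector P.
Proof.
move=> hV; split=> [k p|i j p ip|k a b]; [exact: area_tr| |exact: area_smooth].
have [->{j} _|->{j} jp] := rev2P i j.
  by rewrite transition_jac_id// trmx1 mul1mx mulmx1.
have [x0 xE dJ] := CP1_overlapE ip jp.
rewrite (area_tensorE ip) (area_tensorE jp) xE hV//.
(* Reading the last factor as a double transpose gives the shape $AJA^T$ with $A$ the transposed
   Jacobian. *)
rewrite -scalemxAr -scalemxAl -[X in _ *m X]trmxK area_mx_congr det_tr dJ.
by rewrite scalerA.
Qed.

(** Forms pull back where bivectors push forward, so the determinant factor moves to the other side
    of the gluing law. *)
Lemma area_two_form :
  (forall k x, normsq x != 0 ->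
    h k x = h (rev_ord k) (rV_of_C (C_of_rV x)^-1) / normsq x ^+ 2) ->
  is_two_form P.
Proof.
move=> hV; split=> [k p|i j p ip|k a b]; [exact: area_tr| |exact: area_smooth].
have [->{j} _|->{j} jp] := rev2P i j.
  by rewrite transition_jac_id// trmx1 mul1mx mulmx1.
have [x0 xE dJ] := CP1_overlapE ip jp.
rewrite (area_tensorE ip) (area_tensorE jp) hV// xE.
rewrite -scalemxAr -scalemxAl area_mx_congr.
by rewrite dJ scalerA.
Qed.

Lemma area_nondegenerate : (forall k x, h k x != 0) ->
  forall k p, CP1_dom k p -> bijective (fun v : 'rV[R]_2 => v *m P k p).
Proof. by move=> h0 k p kp; rewrite area_tensorE//; exact: mul_area_mx_bij. Qed.
End AreaTensors.

(** A criterion that serves both for the Fubini-Study bivector and for its deformation. *)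
Lemma area_symplectic (R : realType) (h : 'I_2 -> 'rV[R]_2 -> R)
    (P : tensor2_comps (CP1_manifold R)) :
  (forall k, smooth_on setT (h k)) -> (forall k x, h k x != 0) ->
  (forall k x, normsq x != 0 ->
    h (rev_ord k) (rV_of_C (C_of_rV x)^-1) = h k x / normsq x ^+ 2) ->
  (forall k x, P k (CP1_param k x) = h k x *: area_mx R) ->
  [/\ poisson_structure P, nondegenerate_bivector P &
      exists w : tensor2_comps (CP1_manifold R), symplectic_form w /\ induces w P].
Proof.
move=> sh h0 hV PE; split.
- split=> [|k p kp a b c]; first exact: area_bivector sh PE hV.
  exact: area_schouten sh PE _ _ _ _ _ kp.
- exact: area_nondegenerate PE h0.
(* Chosen so that $(h'J)(hJ)=-h'h=1$. Taking reciprocals turns the gluing law of bivector densities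
   into that of form densities. *)
pose h' k x := - (h k x)^-1.
pose w : tensor2_comps (CP1_manifold R) := fun k p => h' k (CP1_chart k p) *: area_mx R.
have wE k x : w k (CP1_param k x) = h' k x *: area_mx R by rewrite /w CP1_paramK.
have sh' k : smooth_on setT (h' k).
  move=> m; apply: (@Ck_ext _ _ _ _ (cst (-1) \* (fun x => (h k x)^-1))).
  - exact: openT.
  - by move=> x _; rewrite /= mulN1r.
  - apply: CkM; [exact: openT|exact: Ck_cst|].
    by apply: CkV; [exact: openT|by move=> x _; exact: h0|exact: sh].
exists w; split.
  split=> [||k p kp a b c].
  - apply: area_two_form sh' wE _ => k x x0.
    by rewrite /h' hV// invfM invrK mulNr mulfK// expf_neq0.
  - by apply: area_nondegenerate wE _ => k x; rewrite oppr_eq0 invr_eq0.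
  - exact: area_ext_deriv sh' wE _ _ _ _ _.
move=> k p kp v; rewrite /sharp /contract (area_tensorE PE kp) /w.
by rewrite -mulmxA area_mx_mul /h' mulNr opprK mulVf// mulmx1.
Qed.

(** * The fundamental bivector of a twist *)

Lemma su2_basis_sqr (R : realType) :
  [/\ val (e1 R) *m val (e1 R) = (-1)%:M, val (e2 R) *m val (e2 R) = (-1)%:M
    & val (e3 R) *m val (e3 R) = (-1)%:M].
Proof.
by split; apply: mx2P; rewrite !mxE !(big_rev2 0) !mxE/=;
  apply/eqP; rewrite eq_complex/=; apply/andP; split; apply/eqP; ring.
Qed.

Lemma normsq_inv (R : realType) (x : 'rV[R]_2) :
  normsq (rV_of_C (C_of_rV x)^-1) = (normsq x)^-1.
Proof.
(* At the origin both sides are 0 by the convention $0^{-1}=0$. *)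
rewrite /normsq !mxE/=; have [x0|x0] := eqVneq (x 0 0 ^+ 2 + x 0 1 ^+ 2) 0.
  by rewrite x0 invr0 !mulr0 oppr0 expr0n addr0.
by field.
Qed.

Section Fundamental.
Variables (R : realType) (l12 l13 l23 : R).

(** Divided by $(|w|^2+1)^2$, this is half the linear function with coefficients $\lambda$ on the
    unit sphere, in stereographic coordinates. *)
Definition twist_density (k : 'I_2) (x : 'rV[R]_2) : R :=
  (normsq x + 1) * ((-1) ^+ k * (l12 * (normsq x - 1) - 2 * l23 * x 0 1) +
                    2 * l13 * x 0 0) / 2.

(** In chart 0 the fields of [e1], [e2], [e3] are $-(1+w^2)$, $i(1-w^2)$, $-2iw$, and $a\wedge b$
    has coefficient $\mathrm{Im}(\bar a b)$. In chart 1 the first and third expressions change sign,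
    whence the factor $(-1)^k$ on the [l12] and [l23] terms. *)
Lemma CP1_fundamentalE k x :
  CP1_fundamental (su2_twist l12 l13 l23) k (CP1_param k x) =
  twist_density k x *: area_mx R.
Proof.
have [q1 q2 q3] := su2_basis_sqr R.
by apply: matrix2P; rewrite !mxE /su2_twist /twist_wedge !fundamental_field_CP1//;
  rewrite /twist_density /normsq; move: k; apply: ord2P;
  rewrite !mxE/= ?expr0 ?expr1; field.
Qed.

(** With $N=|w|^2$, inversion sends $N+1$, $N-1$, $x$, $y$ to $(N+1)/N$, $-(N-1)/N$, $x/N$, $-y/N$;
    the change of $(-1)^k$ between the charts absorbs both minus signs. *)
Lemma twist_density_inv k x : normsq x != 0 ->
  twist_density (rev_ord k) (rV_of_C (C_of_rV x)^-1) =
  twist_density k x / normsq x ^+ 2.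
Proof.
move=> x0; rewrite /twist_density normsq_inv !mxE/= -/(normsq x).
by move: k; apply: ord2P; rewrite /= ?expr0 ?expr1; field.
Qed.

Lemma twist_density_smooth k : smooth_on setT (twist_density k).
Proof.
move=> m; have Cx i : Ck m setT (fun x : 'rV[R]_2 => x 0 i) by exact: Ck_coord.
have Cc (c : R) : Ck m setT (cst c : 'rV[R]_2 -> R) by exact: Ck_cst.
have CN := @normsq_Ck R m setT openT.
pose e : R := (-1) ^+ k.
have := CkM openT (CkD openT CN (Cc 1))
  (CkD openT (CkM openT (Cc (e * l12 / 2)) (CkD openT CN (Cc (- 1))))
    (CkD openT (CkM openT (Cc (- (e * l23))) (Cx 1)) (CkM openT (Cc l13) (Cx 0)))).
apply: Ck_ext; first exact: openT.
by move=> x _; rewrite /twist_density /= -/e; field.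
Qed.

Lemma twist_density_gt k x : l12 ^+ 2 + l13 ^+ 2 + l23 ^+ 2 < 1 ->
  - (normsq x + 1) ^+ 2 < twist_density k x.
Proof.
move=> l1; set N := normsq x.
have N1 : 0 < N + 1 by rewrite ltr_wpDl// addr_ge0// sqr_ge0.
pose e : R := (-1) ^+ k; have e2 : e ^+ 2 = 1 by exact: sqrr_sign.
(* The vector $V$ with the chart sign [e] included; [ABC] then amounts to $(N-1)^2+4N=(N+1)^2$. *)
pose A := e * (N - 1); pose B := 2 * x 0 0; pose C := - (e * 2 * x 0 1).
have ABC : A ^+ 2 + B ^+ 2 + C ^+ 2 = (N + 1) ^+ 2.
  have -> : A ^+ 2 + B ^+ 2 + C ^+ 2 =
      e ^+ 2 * (N - 1) ^+ 2 + 4 * x 0 0 ^+ 2 + e ^+ 2 * 4 * x 0 1 ^+ 2.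
    by rewrite /A /B /C; ring.
  by rewrite e2 /N /normsq; ring.
have -> : twist_density k x = (N + 1) * (l12 * A + l13 * B + l23 * C) / 2.
  by rewrite /twist_density /A /B /C -/e -/N; ring.
set L := l12 * A + _ + _.
have L0 : 0 < N + 1 + L.
  have lN : (l12 ^+ 2 + l13 ^+ 2 + l23 ^+ 2) * (N + 1) ^+ 2 < (N + 1) ^+ 2.
    by rewrite gtr_pMl ?exprn_gt0.
  (* Cauchy-Schwarz, from 0 <= |(N + 1) lambda + V|^2 with V = (A, B, C). *)
  have h1 := sqr_ge0 (l12 * (N + 1) + A); have h2 := sqr_ge0 (l13 * (N + 1) + B).
  have h3 := sqr_ge0 (l23 * (N + 1) + C).
  by rewrite -(pmulr_rgt0 _ N1) /L; lra.
(* The density is $(N+1)L/2$, so the bound on $L$ yields more than $-(N+1)^2/2$; positivity of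
   $(N+1)^2$ accounts for the other half. *)
have : 0 < (N + 1) * (N + 1 + L) by exact: mulr_gt0.
have : 0 < (N + 1) * (N + 1) by exact: mulr_gt0.
lra.
Qed.
End Fundamental.

(** * The Fubini-Study bivector and its deformation *)

Definition FS_density (R : realType) (x : 'rV[R]_2) : R := - (normsq x + 1) ^+ 2.

Lemma FS_density_smooth (R : realType) : smooth_on setT (@FS_density R).
Proof.
move=> m; have C1 := CkD openT (@normsq_Ck R m setT openT) (@Ck_cst R 2 m setT 1).
have := CkM openT (@Ck_cst R 2 m setT (-1)) (CkM openT C1 C1).
apply: Ck_ext; first exact: openT.
by move=> x _; rewrite /FS_density /=; ring.
Qed.

Lemma FS_density_inv (R : realType) (x : 'rV[R]_2) : normsq x != 0 ->
  FS_density (rV_of_C (C_of_rV x)^-1) = FS_density x / normsq x ^+ 2.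
Proof. by move=> x0; rewrite /FS_density normsq_inv; field. Qed.

Theorem theorem4p1 (R : realType) (l12 l13 l23 : R) :
  l12 ^+ 2 + l13 ^+ 2 + l23 ^+ 2 < 1 ->
  exists piFS : tensor2_comps (CP1_manifold R),
    [/\ poisson_structure piFS, nondegenerate_bivector piFS, induces (@omegaFS R) piFS &
        let piFSt : tensor2_comps (CP1_manifold R) :=
          tensor2_sub piFS (CP1_fundamental (su2_twist l12 l13 l23)) in
        [/\ poisson_structure piFSt, nondegenerate_bivector piFSt &
            exists omegaFSt : tensor2_comps (CP1_manifold R),
              symplectic_form omegaFSt /\ induces omegaFSt piFSt]].
Proof.
move=> l1; pose pi : tensor2_comps (CP1_manifold R) :=
  fun k p => FS_density (CP1_chart k p) *: area_mx R.
have N1 (x : 'rV[R]_2) : 0 < normsq x + 1 by rewrite ltr_wpDl// addr_ge0// sqr_ge0.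
have [] := @area_symplectic R (fun=> @FS_density R) pi.
- by move=> _; exact: FS_density_smooth.
- by move=> _ x; rewrite /FS_density oppr_eq0 expf_neq0// gt_eqF.
- by move=> _ x; exact: FS_density_inv.
- by move=> k x; rewrite /pi CP1_paramK.
(* The form supplied by the criterion is discarded: the bivector has to be induced by [omegaFS]
   itself. This is checked directly, the minus sign in [FS_density] cancelling the one from
   $J^2=-1$. *)
move=> poisson_pi nondeg_pi _; exists pi; split=> //.
  move=> k p kp v; rewrite /sharp /contract /omegaFS /pi -/(area_mx R).
  rewrite -mulmxA area_mx_mul /FS_density mulrN opprK mulVf ?mulmx1//.
  by rewrite expf_neq0// gt_eqF.
apply: (@area_symplectic R (fun k x => FS_density x - twist_density l12 l13 l23 k x)).
- move=> k m; have := CkD openT (@FS_density_smooth R m)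
    (CkM openT (@Ck_cst R 2 m setT (-1)) (@twist_density_smooth R l12 l13 l23 k m)).
  by apply: Ck_ext; [exact: openT|move=> x _; rewrite /= mulN1r].
- move=> k x; rewrite lt_eqF// subr_lt0.
  exact: twist_density_gt.
- by move=> k x x0; rewrite FS_density_inv// twist_density_inv// mulrBl.
- by move=> k x; rewrite /tensor2_sub CP1_fundamentalE /pi CP1_paramK scalerBl.
Qed.
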